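(* Let $M$ be a finitely generated $A_n$-module with a system of generators $\{f_1,\dots,f_m\}$, and let $\{M_r\}_{r\in\mathbb N}$ be the corresponding filtration of $M$ with respect to the Bernstein filtration $\{B_r\}_{r\in\mathbb N}$, that is, $M_r=\sum_{i=1}^mB_rf_i$. Furthermore, let $E$ be a free $A_n$-module with basis $e_1,\dots,e_m$, let $N$ be the kernel of the natural epimorphism $\pi:E\to M$ $(e_i\mapsto f_i)$, and let $G=\{g_1,\dots,g_s\}$ be a Gröbner basis of $N$. For any $i=1,\dots,m$, let $V_i$ be the set of all $(\alpha_1,\dots,\alpha_n,\beta_1,\dots,\beta_n)\in\mathbb N^{2n}$ such that $x_1^{\alpha_1}\cdots x_n^{\alpha_n}\partial_1^{\beta_1}\cdots\partial_n^{\beta_n}e_i$ is not a multiple of any $LM(g_j)$ $(1\le j\le s)$. Then there exists a numerical polynomial $\chi(t)$ in one indeterminate $t$ such that: (i) $\chi(r)=\dim_K(M_r)$ for all sufficiently large $r\in\mathbb Z$, that is, there exists $r_0\in\mathbb Z$ such that the equality holds for all $r\ge r_0$. (ii) $\deg(\chi(t))\le 2n$, and the polynomial $\chi(t)$ can be represented as $$\chi(t)=\sum_{i=0}^{2n}a_i\binom{t+i}{i},$$ where $a_i\in\mathbb Z$ for $i=0,\dots,2n$. (iii) $$\chi(t)=\sum_{i=1}^m\omega_i(t),$$ where $\omega_i(t)=\omega_{V_i}(t)$, and $\omega_{V_i}(t)$ is the Kolchin polynomial of the set $V_i\subseteq\mathbb N^{2n}$ $(1\le i\le m)$.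
   Context: Let $K$ be a field and $n\ge 1$. $A_n=A_n(K)$ is the $n$th Weyl algebra: the $K$-subalgebra of $\mathrm{End}_K(K[x_1,\dots,x_n])$ generated by the multiplication operators $x_1,\dots,x_n$ and the partial derivatives $\partial_1,\dots,\partial_n$. Modules are unitary left modules. $\mathbb N$ includes $0$. For $\alpha,\beta\in\mathbb N^n$, $x^\alpha\partial^\beta=x_1^{\alpha_1}\cdots x_n^{\alpha_n}\partial_1^{\beta_1}\cdots\partial_n^{\beta_n}$ is called a monomial, of degree $|\alpha|+|\beta|=\sum_i\alpha_i+\sum_i\beta_i$. $\Theta$ is the set of all monomials; it is taken as known that each element of $A_n$ can be written in a unique way as a finite $K$-linear combination of monomials. The Bernstein filtration is $\{B_r\}_{r\in\mathbb N}$, where $B_r$ is the $K$-vector space generated by the monomials of degree $\le r$. Order on $\Theta$: $x^\alpha\partial^\beta<x^\gamma\partial^\delta$ iff $(|\alpha|+|\beta|,\alpha_1,\dots,\alpha_n,\beta_1,\dots,\beta_n)$ is smaller than $(|\gamma|+|\delta|,\gamma_1,\dots,\gamma_n,\delta_1,\dots,\delta_n)$ in the lexicographic order on $\mathbb N^{2n+1}$. Divisibility: $x^\alpha\partial^\beta$ divides $x^\gamma\partial^\delta$ iff $\alpha_i\le\gamma_i$ and $\beta_i\le\delta_i$ for all $i$. For $E$ free on $e_1,\dots,e_m$, the monomials of $E$ are the elements of $\Theta e=\{\theta e_i:\theta\in\Theta,\ 1\le i\le m\}$, regarded as a $K$-basis of $E$, ordered by $\theta e_i<\theta'e_j$ iff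 $\theta<\theta'$, or $\theta=\theta'$ and $i<j$. $\theta'e_i$ is a multiple of $\theta e_j$ (and $\theta e_j$ divides $\theta'e_i$) iff $i=j$ and $\theta$ divides $\theta'$. For $0\ne f\in E$, $LM(f)$ is the greatest monomial appearing in $f$ with nonzero coefficient. A finite set $G=\{g_1,\dots,g_s\}$ of nonzero elements contained in a submodule $N\subseteq E$ is a Gröbner basis for $N$ if for any nonzero $f\in N$ there exists $g_i\in G$ such that $LM(g_i)$ divides $LM(f)$. A polynomial $f(t)\in\mathbb Q[t]$ is numerical if $f(r)\in\mathbb Z$ for all sufficiently large $r\in\mathbb N$. Here $\binom{t}{0}=1$ and $\binom{t}{k}=t(t-1)\cdots(t-k+1)/k!$ for $k\ge1$. For $A\subseteq\mathbb N^q$, $V_A$ denotes the set of all $v\in\mathbb N^q$ that are not greater than or equal to any element of $A$ in the product (componentwise) order, and for $V\subseteq\mathbb N^q$ and $r\in\mathbb N$, $V(r)=\{v\in V:v_1+\cdots+v_q\le r\}$. The Kolchin (dimension) polynomial $\omega_A(t)$ of $A\subseteq\mathbb N^q$ is the numerical polynomial, known to exist, with $\omega_A(r)=\mathrm{Card}\,V_A(r)$ for all sufficiently large $r\in\mathbb N$.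
   Formalization: K is assumed of characteristic 0 (otherwise the monomials are not a K-basis of A_n), and ω_{V_i} is read as the numerical polynomial equal to Card V_i(r) for large r, i.e. ω_A with V_A = V_i, since literally counting V_{V_i} makes (iii) false, e.g. for N = 0. *)

(* Defs.v *)
(* The axioms of boolp equip End_K(K[x_1, ..., x_n]) with a choiceType structure
   and make subalgebra membership Boolean. *)
From HB Require Import structures.
From mathcomp Require Import all_boot all_order all_algebra.
From mathcomp Require Import boolp.
From mathcomp Require Import mpoly.

Set Implicit Arguments.
Unset Strict Implicit.
Unset Printing Implicit Defensive.

Import Order.TTheory GRing.Theory Num.Theory.
Local Open Scope ring_scope.

(** * The Weyl algebra *)

Definition endo (K : fieldType) (n : nat) : Type :=
  {linear {mpoly K[n]} -> {mpoly K[n]}}.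

Section EndoAlgebra.
Variables (K : fieldType) (n : nat).
Local Notation V := {mpoly K[n]}.
Local Notation endo := (endo K n).

Definition endo_fun (f : endo) : V -> V := @GRing.Linear.sort K V V *:%R f.

Lemma endoP (f g : endo) : endo_fun f =1 endo_fun g -> f = g.
Proof.
case: f g => [f [[fD] [fZ]]] [g [[gD] [gZ]]] /= fg.
have {fg} /= efg : f = g by apply/funext.
case: g / efg gD gZ => gD gZ.
by rewrite (Prop_irrelevance fD gD) (Prop_irrelevance fZ gZ).
Qed.

HB.instance Definition _ := gen_eqMixin endo.
HB.instance Definition _ := gen_choiceMixin endo.

Definition endo_zero : endo := (\0 : V -> V).
Definition endo_opp (f : endo) : endo := \- (f : {linear V -> V}).
Definition endo_add (f g : endo) : endo :=
  (f : {linear V -> V}) \+ (g : {linear V -> V}).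
Definition endo_one : endo := (idfun : V -> V).
Definition endo_mul (f g : endo) : endo :=
  (f : {linear V -> V}) \o (g : {linear V -> V}).
Definition endo_scale (c : K) (f : endo) : endo :=
  c \*: (f : {linear V -> V}).

Fact endo_addA : associative endo_add.
Proof. by move=> f g h; apply: endoP => p; apply: addrA. Qed.
Fact endo_addC : commutative endo_add.
Proof. by move=> f g; apply: endoP => p; apply: addrC. Qed.
Fact endo_add0 : left_id endo_zero endo_add.
Proof. by move=> f; apply: endoP => p; apply: add0r. Qed.
Fact endo_addN : left_inverse endo_zero endo_opp endo_add.
Proof. by move=> f; apply: endoP => p; apply: addNr. Qed.

HB.instance Definition _ :=
  GRing.isZmodule.Build endo endo_addA endo_addC endo_add0 endo_addN.

Fact endo_mulA : associative endo_mul.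
Proof. by move=> f g h; apply: endoP. Qed.
Fact endo_mul1 : left_id endo_one endo_mul.
Proof. by move=> f; apply: endoP. Qed.
Fact endo_mulr1 : right_id endo_one endo_mul.
Proof. by move=> f; apply: endoP. Qed.
Fact endo_mulDl : left_distributive endo_mul +%R.
Proof. by move=> f g h; apply: endoP. Qed.
Fact endo_mulDr : right_distributive endo_mul +%R.
Proof.
move=> f g h; apply: endoP => p.
exact: (linearD (f : {linear V -> V})).
Qed.
Fact endo_one_neq0 : endo_one != 0.
Proof.
apply/eqP => /(congr1 (fun f => endo_fun f 1)) /eqP.
by rewrite /= oner_eq0.
Qed.

HB.instance Definition _ := GRing.Zmodule_isNzRing.Build endo
  endo_mulA endo_mul1 endo_mulr1 endo_mulDl endo_mulDr endo_one_neq0.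

Fact endo_scaleA (a b : K) (f : endo) :
  endo_scale a (endo_scale b f) = endo_scale (a * b) f.
Proof. by apply: endoP => p; apply: scalerA. Qed.
Fact endo_scale1 : left_id 1 endo_scale.
Proof. by move=> f; apply: endoP => p; apply: scale1r. Qed.
Fact endo_scaleDr : right_distributive endo_scale +%R.
Proof. by move=> a f g; apply: endoP => p; apply: scalerDr. Qed.
Fact endo_scaleDl (f : endo) : {morph endo_scale^~ f : a b / a + b}.
Proof. by move=> a b; apply: endoP => p; apply: scalerDl. Qed.

HB.instance Definition _ := GRing.Zmodule_isLmodule.Build K endo
  endo_scaleA endo_scale1 endo_scaleDr endo_scaleDl.

Fact endo_scaleAl (a : K) (f g : endo) : a *: (f * g) = (a *: f) * g.
Proof. exact: endoP. Qed.

HB.instance Definition _ := GRing.Lmodule_isLalgebra.Build K endo endo_scaleAl.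

Fact endo_scaleAr (a : K) (f g : endo) : a *: (f * g) = f * (a *: g).
Proof.
apply: endoP => p; apply: esym.
exact: (linearZZ (f : {linear V -> V})).
Qed.

HB.instance Definition _ := GRing.Lalgebra_isAlgebra.Build K endo endo_scaleAr.

Definition mulX (i : 'I_n) (p : V) : V := 'X_i * p.

Fact mulX_linear i : linear (mulX i).
Proof. by move=> c p q; rewrite /mulX mulrDr scalerAr. Qed.

HB.instance Definition _ i :=
  GRing.isLinear.Build K V V *:%R (mulX i) (mulX_linear i).

Definition endo_X (i : 'I_n) : endo := mulX i.
Definition endo_D (i : 'I_n) : endo := mderiv i.

Lemma endo_mulE (f g : endo) p : endo_fun (f * g) p = endo_fun f (endo_fun g p).
Proof. by []. Qed.
Lemma endo_XE i p : endo_fun (endo_X i) p = 'X_i * p. Proof. by []. Qed.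
Lemma endo_DE i p : endo_fun (endo_D i) p = p^`M(i). Proof. by []. Qed.

(* Intersection of all the K-subalgebras containing the x_i and the \partial_i;
   S ranges over Boolean predicates, which loses nothing in a classical setting. *)
Definition generated f : Prop :=
  forall S : {pred endo}, GRing.subalg_closed S ->
    (forall i, endo_X i \in S) -> (forall i, endo_D i \in S) -> f \in S.

Definition weyl_pred : {pred endo} := fun f => `[< generated f >].

Lemma weyl_predP f : reflect (generated f) (f \in weyl_pred).
Proof. exact: asboolP. Qed.

Fact weyl_pred_subalg : GRing.subalg_closed weyl_pred.
Proof.
split=> [|a f g /weyl_predP wf /weyl_predP wg|f g /weyl_predP wf /weyl_predP wg];
  apply/weyl_predP => S cS SX SD; have [S1 SB SM] := cS.
- exact: S1.
- by apply: SB; [apply: wf|apply: wg].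
- by apply: SM; [apply: wf|apply: wg].
Qed.

HB.instance Definition _ := GRing.isSubalgClosed.Build K endo weyl_pred
  (GRing.subalg_closed_semi weyl_pred_subalg).

Record weyl := Weyl { weyl_val : endo; _ : weyl_val \in weyl_pred }.

HB.instance Definition _ := [isSub for weyl_val].
HB.instance Definition _ := [Choice of weyl by <:].
HB.instance Definition _ := [SubChoice_isSubAlgebra of weyl by <:].

Fact weyl_X_subproof i : endo_X i \in weyl_pred.
Proof. by apply/weyl_predP => S _ SX _; apply: SX. Qed.
Fact weyl_D_subproof i : endo_D i \in weyl_pred.
Proof. by apply/weyl_predP => S _ _ SD; apply: SD. Qed.

Definition weyl_X i : weyl := Weyl (weyl_X_subproof i).
Definition weyl_D i : weyl := Weyl (weyl_D_subproof i).

(* The exponent (alpha, beta) is the concatenated multi-index in N^(n + n).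
   The monomials form a K-basis exactly when K has characteristic 0: in
   characteristic p, weyl_D i ^+ p is the zero operator. *)
Definition weyl_mono (v : 'X_{1..n + n}) : weyl :=
  (\prod_(i < n) weyl_X i ^+ v (lshift n i)) *
  (\prod_(i < n) weyl_D i ^+ v (rshift n i)).

(* A finitely supported family of coefficients indexed by the monomials is
   stored as a commutative polynomial in 2n variables; only its coefficients
   are used, not its product. *)
Definition weyl_comb (c : {mpoly K[n + n]}) : weyl :=
  \sum_(v <- msupp c) c@_v *: weyl_mono v.

(* Pitfall: without the parentheses, 'X_{1..n + n < _} is parsed as the type of
   multi-indices of length the Boolean n + n < _. *)
Definition bernstein (r : nat) (a : weyl) : Prop :=
  exists c : 'X_{1..(n + n) < r.+1} -> K,
    a = \sum_(v : 'X_{1..(n + n) < r.+1}) c v *: weyl_mono v.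

End EndoAlgebra.

Section Modules.
Variables (K : fieldType) (n : nat).
Local Notation A := (weyl K n).

Definition generates (M : lmodType A) m (f : 'I_m -> M) : Prop :=
  forall u : M, exists a : 'I_m -> A, u = \sum_i a i *: f i.

Definition free_basis (E : lmodType A) m (e : 'I_m -> E) : Prop :=
  generates e /\
  forall a : 'I_m -> A, \sum_i a i *: e i = 0 -> forall i, a i = 0.

Definition module_filtration (M : lmodType A) m (f : 'I_m -> M)
    (r : nat) (u : M) : Prop :=
  exists b : 'I_m -> A,
    (forall i, bernstein r (b i)) /\ u = \sum_i b i *: f i.

(* S is a K-subspace of M with a basis of d elements; c%:A is the scalar c of K
   seen in the Weyl algebra. *)
Definition has_Kdim (M : lmodType A) (S : M -> Prop) (d : nat) : Prop :=
  exists b : 'I_d -> M,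
    (forall c : 'I_d -> K,
       \sum_i (c i)%:A *: b i = 0 -> forall i, c i = 0) /\
    (forall u, S u <-> exists c : 'I_d -> K, u = \sum_i (c i)%:A *: b i).

(** * Groebner bases *)

(* (v, i) stands for the monomial x^alpha d^beta e_i with v = (alpha, beta). *)
Definition fmono m : Type := ('X_{1..n + n} * 'I_m)%type.

(* The order of multinomials compares mdeg v :: v lexicographically. *)
Definition fmono_lt m (t u : fmono m) : Prop :=
  (t.1 < u.1)%O \/ (t.1 = u.1 /\ (t.2 < u.2)%N).

Definition fmono_dvd m (t u : fmono m) : Prop :=
  t.2 = u.2 /\ (t.1 <= u.1)%MM.

Definition is_LM (E : lmodType A) m (e : 'I_m -> E) (f : E) (t : fmono m)
    : Prop :=
  exists c : 'I_m -> {mpoly K[n + n]},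
    [/\ f = \sum_i weyl_comb (c i) *: e i,
        (c t.2)@_t.1 != 0
      & forall u : fmono m, (c u.2)@_u.1 != 0 -> u = t \/ fmono_lt u t].

Definition groebner_basis (E : lmodType A) m (e : 'I_m -> E)
    (N : E -> Prop) s (g : 'I_s -> E) : Prop :=
  [/\ forall j, g j != 0,
      forall j, N (g j)
    & forall f, N f -> f != 0 ->
        exists j t u, [/\ is_LM e (g j) t, is_LM e f u & fmono_dvd t u]].

Definition LM_free (E : lmodType A) m (e : 'I_m -> E) s (g : 'I_s -> E)
    (i : 'I_m) (v : 'X_{1..n + n}) : Prop :=
  forall j t, is_LM e (g j) t -> ~ fmono_dvd t (v, i).

End Modules.

(** * Numerical polynomials and Kolchin polynomials *)

Definition numerical (f : {poly rat}) : Prop :=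
  exists r0 : nat, forall r : nat, (r0 <= r)%N -> f.[r%:R] \is a Num.int.

Definition binomp (p : {poly rat}) (k : nat) : {poly rat} :=
  (k`!%:R)^-1 *: \prod_(j < k) (p - j%:R%:P).

(* The number of points of V of total degree at most r. *)
Definition card_le q (V : 'X_{1..q} -> Prop) (r : nat) : nat :=
  #|[pred v : 'X_{1..q < r.+1} | `[< V v >]]|.

Definition not_above q (A : 'X_{1..q} -> Prop) (v : 'X_{1..q}) : Prop :=
  forall a, A a -> ~~ (a <= v)%MM.

Definition is_kolchin q (A : 'X_{1..q} -> Prop) (w : {poly rat}) : Prop :=
  numerical w /\
  exists r0 : nat, forall r : nat, (r0 <= r)%N ->
    w.[r%:R] = (card_le (not_above A) r)%:R.

(* The Kolchin polynomial attached to a set V of the form V_A is omega_A, the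
   polynomial that counts the points of V = V_A itself (and not those of V_V). *)
Definition is_kolchin_of q (V : 'X_{1..q} -> Prop) (w : {poly rat}) : Prop :=
  exists A : 'X_{1..q} -> Prop,
    (forall v, V v <-> not_above A v) /\ is_kolchin A w.

(* Main.v *)
(* The associated graded ring of the Bernstein filtration is commutative:
   x^alpha d^beta acts on linear combinations of monomials as multiplication by
   the commutative monomial of exponent (alpha, beta), up to terms of lower total
   degree. Hence leading monomials are multiplicative, and, the order being
   compatible with the degree, division by the Groebner basis does not increase
   the degree. So the images in M of the monomials of degree <= r that are not
   multiples of any LM(g_j) form a K-basis of M_r: they span by reduction along
   the well-founded monomial order, and they are independent since the leading
   monomial of a nonzero element of N is a multiple of some LM(g_j).
   Characteristic 0 enters through the independence of the operators
   x^alpha d^beta.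
   The exponents that are not above any element of a finite set are counted by
   induction on that set, starting from binom(r + q, q) points. *)
Require Import Defs.
From HB Require Import structures.
From mathcomp Require Import all_boot all_order all_algebra.
From mathcomp Require Import boolp.
From mathcomp Require Import ssrcomplements mpoly.

Set Implicit Arguments.
Unset Strict Implicit.
Unset Printing Implicit Defensive.

Import Order.TTheory GRing.Theory Num.Theory.
Local Open Scope ring_scope.

(** * Counting exponents of bounded degree outside finitely many orthants *)

(** An exponent of degree at most r has all its coordinates in 0..r, so it is a q-tuple over
    ['I_r.+1] with sum at most r; such tuples are the partial ordered partitions. *)
Lemma card_bmultinom q r : #|{: 'X_{1..q < r.+1}}| = 'C(q + r, q).
Proof.
have coord_le (v : 'X_{1..q < r.+1}) i : (v i <= r)%N.
  have := bmdeg v; rewrite ltnS; apply: leq_trans.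
  by rewrite mdegE (bigD1 i) //= leq_addr.
pose tuple_of (v : 'X_{1..q < r.+1}) : q.-tuple 'I_r.+1 :=
  [tuple inord (v i) | i < q].
have tuple_ofE v i : tnth (tuple_of v) i = v i :> nat.
  by rewrite tnth_mktuple inordK // ltnS.
have tuple_of_inj : injective tuple_of.
  move=> u v /(congr1 (fun t => tnth t)) uv.
  by apply/val_inj/mnmP => i; rewrite /= -!tuple_ofE uv.
rewrite -card_partial_ord_partitions -cardsT -(card_imset _ tuple_of_inj).
apply/eq_card => t; rewrite inE big_tuple; apply/imsetP/idP => [[v _ ->]|t_le].
  rewrite (eq_bigr (fun i => v i)) => [|i _]; last exact: tuple_ofE.
  by rewrite -mdegE -ltnS bmdeg.
have mdeg_t : (mdeg [multinom tnth t i : nat | i < q] < r.+1)%N.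
  by rewrite ltnS mdegE (eq_bigr (fun i => tnth t i : nat)) // => i _; rewrite mnmE.
exists (BMultinom mdeg_t) => //; apply/eq_from_tnth => i.
by apply/val_inj; rewrite [RHS]tuple_ofE mnmE.
Qed.

Section CountNotAbove.
Variable q : nat.
Implicit Types (a v : 'X_{1..q}) (L : seq 'X_{1..q}).

Definition above_any L v := has (fun a => (a <= v)%MM) L.

Definition count_not_above L r :=
  #|[pred v : 'X_{1..q < r.+1} | ~~ above_any L v]|.

(** Truncated subtraction is adjoint to addition in each coordinate. *)
Lemma lem_add_sub (a b w : 'X_{1..q}) : (b <= w + a)%MM = (b - a <= w)%MM.
Proof.
by apply/mnm_lepP/mnm_lepP => ble i; have := ble i;
  rewrite mnmDE mnmBE leq_subLR addnC.
Qed.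

(** The points avoiding L either avoid a too or are uniquely w + a with |w| <= r - |a|; the bound on
    |a| makes this truncated difference a true one. *)
Lemma count_not_above_cons a L r : (mdeg a <= r)%N ->
  (count_not_above (a :: L) r
   + count_not_above [seq (b - a)%MM | b <- L] (r - mdeg a))%N
  = count_not_above L r.
Proof.
move=> a_le; pose above_a := [pred v : 'X_{1..q < r.+1} | (a <= v)%MM].
rewrite {3}/count_not_above -(cardID above_a) addnC; congr (_ + _)%N; last first.
  by apply/eq_card => v; rewrite !inE /= negb_or andbC.
have shift_lt (w : 'X_{1..q < (r - mdeg a).+1}) : (mdeg (w + a)%MM < r.+1)%N.
  by rewrite mdegD ltnS addnC -leq_subRL // -ltnS bmdeg.
pose shift w := BMultinom (shift_lt w).
have shift_inj : injective shift.
  by move=> u v /(congr1 (@bmnm _ _)) /addIm /val_inj.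
rewrite -[LHS](card_image shift_inj); apply/eq_card => v; rewrite !inE /=.
apply/imageP/andP => [[w w_not ->]|[v_not a_le_v]].
  split; last by apply: lem_addl.
  move: w_not; rewrite inE /above_any has_map; congr (~~ _).
  by apply: eq_has => b /=; rewrite lem_add_sub.
have v_sub : (mdeg (v - a)%MM < (r - mdeg a).+1)%N.
  by rewrite ltnS leq_subRL // -mdegD addmC submK // -ltnS bmdeg.
exists (BMultinom v_sub); last by apply/val_inj => /=; rewrite submK.
move: v_not; rewrite inE /above_any has_map; congr (~~ _).
by apply: eq_has => b /=; rewrite -lem_add_sub submK.
Qed.

Lemma count_not_above_nil r : count_not_above [::] r = 'C(r + q, q).
Proof. by rewrite addnC -card_bmultinom; apply/eq_card. Qed.

End CountNotAbove.

(** * Integral combinations of the binomials binom(t + i, i) *)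

Definition binomial_basis i : {poly rat} := binomp ('X + i%:R%:P) i.

Lemma horner_binomial_basis i r : (binomial_basis i).[r%:R] = 'C(r + i, i)%:R.
Proof.
rewrite /binomial_basis /binomp hornerZ horner_prod.
have -> : \prod_(j < i) ('X + i%:R%:P - j%:R%:P).[r%:R] = ((r + i) ^_ i)%:R :> rat.
  rewrite ffact_prod natr_prod; apply: eq_bigr => j _.
  by rewrite !hornerE natrB ?natrD // (leq_trans (ltnW (ltn_ord j))) ?leq_addl.
by rewrite -bin_ffact natrM mulrCA mulVf ?mulr1 // pnatr_eq0 -lt0n fact_gt0.
Qed.

Lemma size_binomial_basis i : (size (binomial_basis i) <= i.+1)%N.
Proof.
rewrite /binomial_basis /binomp (leq_trans (size_scale_leq _ _)) //.
rewrite (eq_bigr (fun j : 'I_i => 'X - (j%:R - i%:R)%:P)).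
  by rewrite size_prod_XsubC /index_enum -enumT size_enum_ord.
by move=> j _; rewrite polyCB opprB addrA.
Qed.

(** Pascal's rule as an identity of polynomials. Both basis polynomials contain the factor Q = (X +
    i)...(X + 1). *)
Lemma binomial_basis_shift i :
  binomial_basis i.+1 \Po ('X - 1) = binomial_basis i.+1 - binomial_basis i.
Proof.
pose Q : {poly rat} := \prod_(j < i) ('X + i%:R%:P - j%:R%:P).
have -> : binomial_basis i.+1 = i.+1`!%:R^-1 *: (('X + i.+1%:R%:P) * Q).
  rewrite /binomial_basis /binomp big_ord_recl subr0.
  congr (_ *: (_ * _)); apply: eq_bigr => j _.
  by rewrite lift0 -[i.+1]addn1 -[j.+1]addn1 !natrD !polyCD opprD addrACA addrK addrAC.
have -> : binomial_basis i = i.+1`!%:R^-1 *: (i.+1%:R%:P * Q).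
  rewrite mul_polyC scalerA factS natrM invfM mulrAC mulVf ?mul1r //.
  by rewrite pnatr_eq0.
rewrite comp_polyZ comp_polyM -scalerBr -mulrBl addrK comp_polyD comp_polyX comp_polyC.
congr (_ *: _).
have -> : 'X - 1 + i.+1%:R%:P = 'X + i%:R%:P :> {poly rat}.
  by rewrite -addn1 natrD polyCD polyC1 addrACA addNr addr0.
have -> : Q \Po ('X - 1) = \prod_(j < i) ('X + i%:R%:P - j.+1%:R%:P).
  rewrite /Q rmorph_prod; apply: eq_bigr => j _.
  rewrite /= comp_polyB comp_polyD comp_polyX !comp_polyC.
  by rewrite -[j.+1]addn1 natrD polyCD polyC1 opprD [- _ - 1]addrC addrA
             ['X - 1 + _]addrAC.
(* One product of i + 1 factors read twice: splitting off the first gives X + i times the shifted Q,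
   splitting off the last gives X times Q. *)
pose F (j : nat) : {poly rat} := 'X + i%:R%:P - j%:R%:P.
transitivity (\prod_(j < i.+1) F j); first by rewrite big_ord_recl /F subr0.
by rewrite big_ord_recr /= mulrC /F addrK.
Qed.

(** The form required of the dimension polynomial. It yields both the degree bound and integer
    values, and survives the operations of the counting recursion. *)
Definition integer_valued_span q (w : {poly rat}) :=
  exists a : nat -> int, w = \sum_(i < q.+1) (a i)%:~R *: binomial_basis i.

Section IntegerValuedSpan.
Variable q : nat.
Local Notation spanq := (integer_valued_span q).

Lemma integer_valued_span0 : spanq 0.
Proof. by exists (fun=> 0); rewrite big1 // => i _; rewrite scale0r. Qed.

Lemma integer_valued_spanD u v : spanq u -> spanq v -> spanq (u + v).
Proof.
move=> [a ->] [b ->]; exists (fun i => a i + b i).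
by rewrite -big_split; apply: eq_bigr => i _ /=; rewrite rmorphD scalerDl.
Qed.

Lemma integer_valued_spanN u : spanq u -> spanq (- u).
Proof.
move=> [a ->]; exists (fun i => - a i).
by rewrite -sumrN; apply: eq_bigr => i _; rewrite rmorphN scaleNr.
Qed.

Lemma integer_valued_span_basis i : (i <= q)%N -> spanq (binomial_basis i).
Proof.
rewrite -ltnS => lt_iq; exists (fun j => (j == i)%:R).
rewrite (bigD1 (Ordinal lt_iq)) //= eqxx scale1r big1 ?addr0 // => j ne_ji.
by rewrite -(inj_eq val_inj) /= in ne_ji; rewrite (negbTE ne_ji) scale0r.
Qed.

Lemma integer_valued_spanZ (c : int) u : spanq u -> spanq (c%:~R *: u).
Proof.
move=> [a ->]; exists (fun i => c * a i).
by rewrite scaler_sumr; apply: eq_bigr => i _; rewrite scalerA -rmorphM.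
Qed.

Lemma integer_valued_span_sum (I : Type) (r : seq I) (F : I -> {poly rat}) :
  (forall i, spanq (F i)) -> spanq (\sum_(i <- r) F i).
Proof.
move=> FP; elim/big_ind: _ => //; first exact: integer_valued_span0.
exact: integer_valued_spanD.
Qed.

(** A shift by d iterates unit shifts; a unit shift fixes the constant basis polynomial and acts on
    the others by Pascal's rule, with integer coefficients. *)
Lemma integer_valued_span_shift u d :
  spanq u -> spanq (u \Po ('X - d%:R%:P)).
Proof.
move=> uP; elim: d => [|d IHd]; first by rewrite subr0 comp_polyXr.
have -> : u \Po ('X - d.+1%:R%:P) = u \Po ('X - d%:R%:P) \Po ('X - 1).
  rewrite -comp_polyA; congr (_ \Po _).
  rewrite comp_polyB comp_polyX comp_polyC -addn1 natrD polyCD polyC1.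
  by rewrite opprD [- _ - 1]addrC addrA.
case: IHd => a ->; rewrite rmorph_sum; apply: integer_valued_span_sum => i.
rewrite /= comp_polyZ; apply: integer_valued_spanZ.
case: i => -[_|i lt_iq] /=.
  have basis0 : binomial_basis 0 = 1%:P.
    by rewrite /binomial_basis /binomp big_ord0 fact0 invr1 scale1r polyC1.
  by rewrite basis0 comp_polyC -basis0; apply: integer_valued_span_basis.
rewrite binomial_basis_shift; apply: integer_valued_spanD.
  exact: integer_valued_span_basis.
by apply/integer_valued_spanN/integer_valued_span_basis/ltnW.
Qed.

Lemma size_integer_valued_span u : spanq u -> (size u <= q.+1)%N.
Proof.
move=> [a ->]; apply: (leq_trans (size_sum _ _ _)); apply/bigmax_leqP => i _.
apply: (leq_trans (size_scale_leq _ _)); apply: (leq_trans (size_binomial_basis _)).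
exact: ltn_ord.
Qed.

Lemma numerical_integer_valued_span u : spanq u -> numerical u.
Proof.
move=> [a ->]; exists 0%N => r _; rewrite horner_sum rpred_sum // => i _.
by rewrite hornerZ horner_binomial_basis rpredM ?rpred_int ?rpred_nat.
Qed.

End IntegerValuedSpan.

(* Removing a from the list adds back the points a + w, where w avoids the
   differences b - a. *)
Lemma count_not_above_polynomial q (L : seq 'X_{1..q}) :
  exists w : {poly rat}, integer_valued_span q w /\
    exists r0, forall r, (r0 <= r)%N -> w.[r%:R] = (count_not_above L r)%:R.
Proof.
(* Induction on the length, because the recursion also visits the list of differences b - a, which
   is not a sublist. *)
elim: {L}(size L) {-2}L (erefl (size L)) => [|k IHk] [|a L] //= => [_|[sizeL]].
  exists (binomial_basis q); split; first exact: integer_valued_span_basis.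
  by exists 0%N => r _; rewrite horner_binomial_basis count_not_above_nil.
have [w1 [w1P [r1 w1E]]] := IHk L sizeL.
have [|w2 [w2P [r2 w2E]]] := IHk [seq (b - a)%MM | b <- L]; first by rewrite size_map.
exists (w1 - (w2 \Po ('X - (mdeg a)%:R%:P))); split.
  apply: integer_valued_spanD => //.
  exact/integer_valued_spanN/integer_valued_span_shift.
(* Large enough for r >= r1, for r - |a| >= r2, and for |a| <= r. *)
exists (r1 + r2 + mdeg a)%N => r le_r.
have le_ar : (mdeg a <= r)%N by apply: leq_trans le_r; rewrite leq_addl.
rewrite hornerD hornerN horner_comp !hornerE -natrB // w1E ?w2E.
- by rewrite -(count_not_above_cons L le_ar) natrD addrK.
- by rewrite leq_subRL // (leq_trans _ le_r) // addnC leq_add2r leq_addl.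
- by apply: leq_trans le_r; rewrite -addnA leq_addr.
Qed.

(** The elements of L form the set A with V = V_A. The count is also stated for V itself, since
    [is_kolchin_of] hides A. *)
Lemma exists_kolchin q (V : 'X_{1..q} -> Prop) (L : seq 'X_{1..q}) :
  (forall v, V v <-> ~~ above_any L v) ->
  exists w, [/\ integer_valued_span q w, is_kolchin_of V w
    & exists r0, forall r, (r0 <= r)%N -> w.[r%:R] = (card_le V r)%:R].
Proof.
move=> VE; have [w [wP [r0 wE]]] := count_not_above_polynomial L.
have cardE W : (forall v, W v <-> ~~ above_any L v) ->
    forall r, (r0 <= r)%N -> w.[r%:R] = (card_le W r)%:R.
  move=> WE r le_r; rewrite wE //; congr (_%:R); apply: eq_card => v.
  by rewrite !inE; apply/idP/asboolP => /WE.
exists w; split=> //; last by exists r0; apply: cardE.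
have LE v : not_above (fun a => a \in L) v <-> ~~ above_any L v.
  by split=> [vL|/hasPn //]; apply/hasPn.
exists (fun a => a \in L); split; first by move=> v; split=> [/VE/LE|/LE/VE].
split; first exact: numerical_integer_valued_span wP.
by exists r0; apply: cardE.
Qed.

(** * Commutative symbols of Weyl operators *)

Section WeylAction.
Variables (K : fieldType) (n : nat).
Local Notation A := (weyl K n).
Local Notation V := {mpoly K[n]}.

Definition weyl_act (a : A) (p : V) : V := endo_fun (weyl_val a) p.

Lemma weyl_act_inj a b : weyl_act a =1 weyl_act b -> a = b.
Proof. by move=> ab; apply/val_inj/endoP. Qed.

Lemma weyl_actM a b p : weyl_act (a * b) p = weyl_act a (weyl_act b p).
Proof. by []. Qed.

Lemma weyl_actD a b p : weyl_act (a + b) p = weyl_act a p + weyl_act b p.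
Proof. by []. Qed.

Lemma weyl_actZ c a p : weyl_act (c *: a) p = c *: weyl_act a p.
Proof. by []. Qed.

Lemma weyl_act_sum (I : Type) (r : seq I) (P : pred I) (F : I -> A) p :
  weyl_act (\sum_(i <- r | P i) F i) p = \sum_(i <- r | P i) weyl_act (F i) p.
Proof. by elim/big_rec2: _ => // i x y _ <-. Qed.

Lemma weyl_act_X i p : weyl_act (weyl_X K i) p = 'X_i * p.
Proof. by []. Qed.

Lemma weyl_act_D i p : weyl_act (weyl_D K i) p = p^`M(i).
Proof. by []. Qed.

Definition xpart (v : 'X_{1..n + n}) : 'X_{1..n} :=
  [multinom v (lshift n i) | i < n].
Definition dpart (v : 'X_{1..n + n}) : 'X_{1..n} :=
  [multinom v (rshift n i) | i < n].

Lemma weyl_act_mono v p :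
  weyl_act (weyl_mono K v) p = 'X_[xpart v] * p^`M[dpart v].
Proof.
have actX (a : 'I_n -> nat) q :
    weyl_act (\prod_(i < n) weyl_X K i ^+ a i) q = 'X_[[multinom a i | i < n]] * q.
  rewrite mpolyXE_id.
  under [in RHS]eq_bigr do rewrite mnmE.
  elim/big_rec2: _ q => [|i y1 y2 _ IH] q; first by rewrite mul1r.
  rewrite weyl_actM IH -mulrA; elim: (a i) => [|k IHk]; first by rewrite !expr0 mul1r.
  by rewrite !exprS weyl_actM IHk weyl_act_X mulrA.
have actD (b : 'I_n -> nat) q :
    weyl_act (\prod_(i < n) weyl_D K i ^+ b i) q = q^`M[[multinom b i | i < n]].
  have -> : [multinom b i | i < n] = (\sum_i U_(i) *+ b i)%MM.
    by rewrite [LHS]multinomUE_id; apply: eq_bigr => i _; rewrite mnmE.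
  elim/big_rec2: _ q => [|i a v1 _ IH] q; first by rewrite mderivm0m.
  rewrite weyl_actM addmC mderivmDm -IH; elim: (b i) (weyl_act a q) => [|k IHk] r.
    by rewrite mderivn0.
  by rewrite exprS weyl_actM IHk weyl_act_D mderivnS.
by rewrite /weyl_mono weyl_actM actX actD.
Qed.

Lemma xpartD u v : xpart (u + v) = (xpart u + xpart v)%MM.
Proof. by apply/mnmP => i; rewrite !(mnmE, mnmDE). Qed.

Lemma dpartD u v : dpart (u + v) = (dpart u + dpart v)%MM.
Proof. by apply/mnmP => i; rewrite !(mnmE, mnmDE). Qed.

Lemma xpart1l i : xpart U_(lshift n i) = U_(i)%MM.
Proof. by apply/mnmP => j; rewrite mnmE !mnm1E eq_lshift. Qed.

Lemma dpart1l i : dpart U_(lshift n i) = 0%MM.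
Proof. by apply/mnmP => j; rewrite mnmE mnm1E mnm0E eq_lrshift. Qed.

Lemma xpart1r i : xpart U_(rshift n i) = 0%MM.
Proof. by apply/mnmP => j; rewrite mnmE mnm1E mnm0E eq_rlshift. Qed.

Lemma dpart1r i : dpart U_(rshift n i) = U_(i)%MM.
Proof. by apply/mnmP => j; rewrite mnmE !mnm1E eq_rshift. Qed.

Lemma submm (v : 'X_{1..n}) : (v - v)%MM = 0%MM.
Proof. by apply/mnmP => i; rewrite mnmBE mnm0E subnn. Qed.

Lemma xdpart_inj u v : xpart u = xpart v -> dpart u = dpart v -> u = v.
Proof.
move=> /mnmP xuv /mnmP duv; apply/mnmP => k; case: (split_ordP k) => i ->.
  by have := xuv i; rewrite !mnmE.
by have := duv i; rewrite !mnmE.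
Qed.

End WeylAction.

Section WeylCombinations.
Variables (K : fieldType) (n : nat).
Local Notation A := (weyl K n).
Local Notation comb := (@weyl_comb K n).
Implicit Types (c : {mpoly K[n + n]}).

Lemma weyl_combwE k c : (msize c <= k)%N ->
  comb c = \sum_(v : 'X_{1..(n + n) < k}) c@_v *: weyl_mono K v.
Proof.
move=> le_ck; rewrite /weyl_comb (big_mksub 'X_{1..(n + n) < k}) /=; first last.
- by move=> v /msize_mdeg_lt/leq_trans/(_ le_ck).
- exact: msupp_uniq.
by rewrite big_rmcond //= => v /memN_msupp_eq0 ->; rewrite scale0r.
Qed.

Fact weyl_comb_is_linear : linear comb.
Proof.
move=> a c d; pose k := maxn (msize (a *: c + d)) (maxn (msize c) (msize d)).
rewrite !(@weyl_combwE k) ?leq_max ?leqnn ?orbT //.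
rewrite scaler_sumr -big_split; apply: eq_bigr => v _ /=.
by rewrite mcoeffD mcoeffZ scalerDl scalerA.
Qed.

HB.instance Definition _ :=
  GRing.isLinear.Build K {mpoly K[n + n]} A *:%R comb weyl_comb_is_linear.

Lemma weyl_combX v : comb 'X_[v] = weyl_mono K v.
Proof. by rewrite /weyl_comb msuppX big_seq1 mcoeffX eqxx scale1r. Qed.

(** By linearity, left multiplication by a is determined on coefficient families by its effect on
    single monomials. *)
Lemma weyl_comb_morph a (phi : {linear {mpoly K[n + n]} -> {mpoly K[n + n]}}) :
  (forall v, a * weyl_mono K v = comb (phi 'X_[v])) ->
  forall c, a * comb c = comb (phi c).
Proof.
move=> mono_phi c; rewrite {2}[c]mpolyE !linear_sum mulr_sumr /weyl_comb.
by apply: eq_bigr => v _; rewrite !linearZ /= -scalerAr mono_phi.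
Qed.

Lemma weyl_X_comb i c : weyl_X K i * comb c = comb ('X_(lshift n i) * c).
Proof.
pose phi : {linear {mpoly K[n + n]} -> {mpoly K[n + n]}} :=
  GRing.mull_fun 'X_(lshift n i) idfun.
apply: (@weyl_comb_morph _ phi) => v /=.
rewrite -mpolyXD weyl_combX; apply: weyl_act_inj => p.
rewrite weyl_actM !weyl_act_mono weyl_act_X xpartD dpartD xpart1l dpart1l.
by rewrite add0m mpolyXD mulrA.
Qed.

(** Leibniz rule: moving d_i past x^alpha leaves alpha_i x^(alpha - 1_i), which is the formal
    derivative of the coefficient family in its i-th x-variable. *)
Lemma weyl_D_comb i c :
  weyl_D K i * comb c = comb ('X_(rshift n i) * c + c^`M(lshift n i)).
Proof.
pose phi : {linear {mpoly K[n + n]} -> {mpoly K[n + n]}} :=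
  (GRing.mull_fun 'X_(rshift n i) idfun : {linear _ -> _}) \+ mderiv (lshift n i).
apply: (@weyl_comb_morph _ phi) => v /=.
rewrite -mpolyXD mderivX linearD linearZ /= !weyl_combX; apply: weyl_act_inj => p.
rewrite weyl_actM weyl_actD weyl_actZ !weyl_act_mono weyl_act_D.
rewrite xpartD dpartD xpart1r dpart1r add0m mderivM mderivX addrC.
congr (_ * _ + _).
  by rewrite addmC mderivmDm mderivmU1m.
rewrite -scalerAl mnmE; congr (_ *: ('X_[_] * p^`M[_])).
  by apply/mnmP => j; rewrite !(mnmE, mnmBE, mnm1E) eq_lshift.
by apply/mnmP => j; rewrite !(mnmE, mnmBE, mnm1E) eq_lrshift subn0.
Qed.

(** [msize] is one more than the total degree, and 0 at the zero polynomial; hence the strict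
    inequality here. *)
Lemma msize_leP k c : reflect (forall v, c@_v != 0 -> (mdeg v < k)%N) (msize c <= k)%N.
Proof.
apply: (iffP idP) => [le_ck v|ck].
  by rewrite -mcoeff_msupp => /msize_mdeg_lt/leq_trans; apply.
rewrite msizeE; apply/bigmax_leqP_seq => v; rewrite mcoeff_msupp => v_c _.
exact: ck.
Qed.

Lemma msizeD_leq k c d : (msize c <= k)%N -> (msize d <= k)%N -> (msize (c + d) <= k)%N.
Proof.
move=> ck dk; apply: leq_trans (msizeD_le _ _) _; by rewrite geq_max ck dk.
Qed.

Lemma msize_mderiv i c : (msize c^`M(i) <= msize c)%N.
Proof.
apply/msize_leP => v; rewrite mcoeff_mderiv => v_c.
have : c@_(v + U_(i)) != 0 by apply: contraNneq v_c => ->; rewrite mul0rn.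
rewrite -mcoeff_msupp => /msize_mdeg_lt; apply: leq_trans.
by rewrite ltnS mdegD leq_addr.
Qed.

Lemma mcoeffXM_add u v c : ('X_[u] * c)@_(u + v) = c@_v.
Proof. by rewrite mulrC mcoeffMX. Qed.

Lemma mcoeffXM_neq0 u v c : ('X_[u] * c)@_v != 0 ->
  exists2 w, c@_w != 0 & v = (u + w)%MM.
Proof.
rewrite mulrC -mcoeff_msupp (perm_mem (msuppMX _ _)) => /mapP[w].
by rewrite mcoeff_msupp => w_c ->; exists w.
Qed.

Lemma msizeXM_leq u c k :
  (msize c <= k.+1)%N -> (msize ('X_[u] * c) <= (mdeg u + k).+1)%N.
Proof.
move=> /msize_leP ck; apply/msize_leP => v /mcoeffXM_neq0[w w_c ->].
by rewrite mdegD ltnS leq_add2l -ltnS ck.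
Qed.

(* The product of the associated graded ring is the commutative one: the
   operator a has symbol 'X_[u]. *)
Definition has_symbol (a : A) u := forall k c, (msize c <= k.+1)%N ->
  exists2 c', (msize c' <= mdeg u + k)%N & a * comb c = comb ('X_[u] * c + c').

Lemma has_symbol1 : has_symbol 1 0%MM.
Proof.
by move=> k c _; exists 0; rewrite ?msize0 // mpolyX0 addr0 !mul1r.
Qed.

Lemma has_symbolM a b u v :
  has_symbol a u -> has_symbol b v -> has_symbol (a * b) (u + v)%MM.
Proof.
move=> aS bS k c ck; have [c1 c1k bE] := bS k c ck.
have [|c2 c2k aE] := aS (mdeg v + k)%N ('X_[v] * c + c1).
  by apply: msizeD_leq; [apply: msizeXM_leq|apply: ltnW].
exists ('X_[u] * c1 + c2); last first.
  by rewrite -mulrA bE aE mulrDr addrA mulrA -mpolyXD.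
rewrite mdegD -addnA; apply: msizeD_leq => //.
(* [msizeXM_leq] needs a positive size bound; when the bound is 0, the correction c1 is zero. *)
case: (mdeg v + k)%N c1k => [|k']; last by rewrite addnS; apply: msizeXM_leq.
by rewrite leqn0 msize_poly_eq0 => /eqP ->; rewrite mulr0 msize0.
Qed.

Lemma has_symbolX a u k : has_symbol a u -> has_symbol (a ^+ k) (u *+ k)%MM.
Proof.
move=> aS; elim: k => [|k IHk]; first by rewrite expr0 mulm0n; apply: has_symbol1.
by rewrite exprS mulmS; apply: has_symbolM.
Qed.

Lemma has_symbol_prod (I : Type) (r : seq I) (F : I -> A) (G : I -> 'X_{1..n + n}) :
  (forall i, has_symbol (F i) (G i)) ->
  has_symbol (\prod_(i <- r) F i) (\sum_(i <- r) G i)%MM.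
Proof.
move=> FG; elim/big_rec2: _ => [|i u a _ IH]; first exact: has_symbol1.
exact: has_symbolM.
Qed.

Lemma has_symbol_X i : has_symbol (weyl_X K i) U_(lshift n i)%MM.
Proof. by move=> k c _; exists 0; rewrite ?msize0 // addr0 weyl_X_comb. Qed.

Lemma has_symbol_D i : has_symbol (weyl_D K i) U_(rshift n i)%MM.
Proof.
move=> k c ck; exists c^`M(lshift n i); last by rewrite weyl_D_comb.
by rewrite mdeg1 (leq_trans (msize_mderiv _ _)).
Qed.

Lemma has_symbol_mono u : has_symbol (weyl_mono K u) u.
Proof.
have {2}-> : u = (\sum_i U_(lshift n i) *+ u (lshift n i)
            + \sum_i U_(rshift n i) *+ u (rshift n i))%MM.
  by rewrite [LHS]multinomUE_id big_split_ord.
by apply: has_symbolM; apply: has_symbol_prod => i; apply: has_symbolX;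
  [apply: has_symbol_X|apply: has_symbol_D].
Qed.

(** * Linear independence of the monomials *)

(** Induction on |beta| for u = (alpha, beta): apply the operator to x^beta and read the coefficient
    of x^alpha. The term of u contributes beta!, nonzero in characteristic 0. Every other term
    vanishes: a smaller derivative order by induction, an order not below beta because it kills
    x^beta, and the order beta itself because its power of x differs from x^alpha. *)
Lemma weyl_comb_inj : [pchar K] =i pred0 -> injective comb.
Proof.
move=> /pcharf0P charK; apply: raddf_inj => c c0; apply/mpolyP => u; rewrite mcoeff0.
have [d] := ubnP (mdeg (dpart u)); elim: d u => // d IHd u; rewrite ltnS => le_ud.
have [u_c|] := boolP (u \in msupp c); last exact: memN_msupp_eq0.
have : (weyl_act (comb c) 'X_[dpart u])@_(xpart u) = 0 by rewrite c0 mcoeff0.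
have diag : (weyl_act (weyl_mono K u) 'X_[dpart u])@_(xpart u)
    = (\prod_(i < n) (dpart u i)`!)%:R.
  rewrite weyl_act_mono mderivmX submm mpolyX0 -scalerAr mulr1.
  rewrite mcoeffZ mcoeffX eqxx mulr1.
  by congr (_%:R); apply: eq_bigr => i _; rewrite ffactnn.
rewrite /weyl_comb weyl_act_sum raddf_sum (bigD1_seq u) ?msupp_uniq //=.
rewrite weyl_actZ mcoeffZ diag [X in _ + X]big1 ?addr0 => [/eqP|v ne_vu].
  rewrite mulf_eq0 charK => /orP[/eqP //|].
  by rewrite -[_ == 0%N]negbK -lt0n prodn_gt0 // => i; apply: fact_gt0.
rewrite weyl_actZ mcoeffZ; have [lt_vu|le_uv] := ltnP (mdeg (dpart v)) (mdeg (dpart u)).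
  by rewrite IHd ?mul0r // (leq_trans lt_vu).
rewrite weyl_act_mono mderivmX -scalerAr mcoeffZ.
have [le_dvu|/mnm_lepP/existsNP[i /negP]] := boolP (dpart v <= dpart u)%MM; last first.
  by rewrite -ltnNge => lt_i; rewrite (bigD1 i) //= ffact_small // mul0n mul0r mulr0.
have dE : dpart v = dpart u.
  rewrite -(submK le_dvu) in le_uv *; apply/esym/eqP; move: le_uv.
  rewrite mdegD -{2}[mdeg (dpart v)]add0n leq_add2r leqn0 mdeg_eq0 => /eqP ->.
  by rewrite add0m.
rewrite dE submm mpolyX0 mulr1 mcoeffX.
case: eqVneq => [xE|_]; last by rewrite !mulr0.
by rewrite (xdpart_inj xE dE) eqxx in ne_vu.
Qed.

End WeylCombinations.

(** * Leading monomials and normal forms *)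

Section ModuleCombinations.
Variables (K : fieldType) (n : nat).
Local Notation A := (weyl K n).
Local Notation comb := (@weyl_comb K n).
Local Notation poly2n := {mpoly K[n + n]}.

Lemma bernsteinP r (a : A) :
  bernstein r a <-> exists2 c : poly2n, (msize c <= r.+1)%N & a = comb c.
Proof.
split=> [[c ->]|[c c_r ->]]; last by exists (fun v => c@_v); apply: weyl_combwE.
exists (\sum_(v : 'X_{1..(n + n) < r.+1}) c v *: 'X_[v]).
  apply: (leq_trans (msize_sum _ _ _)); apply/bigmax_leqP => v _.
  by rewrite (leq_trans (msizeZ_le _ _)) // msizeX bmdeg.
by rewrite linear_sum; apply: eq_bigr => v _; rewrite linearZ /= weyl_combX.
Qed.

Lemma scale_weylZ (N : lmodType A) (k : K) (a : A) (u : N) :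
  (k *: a) *: u = k%:A *: (a *: u).
Proof. by rewrite scalerA mulr_algl. Qed.

Section Family.
Variables (N : lmodType A) (m : nat) (f : 'I_m -> N).

Definition module_comb (c : 'I_m -> poly2n) : N := \sum_i comb (c i) *: f i.

Lemma eq_module_comb c d : c =1 d -> module_comb c = module_comb d.
Proof. by move=> cd; apply: eq_bigr => i _; rewrite cd. Qed.

Lemma module_comb0 : module_comb (fun=> 0) = 0.
Proof. by apply: big1 => i _; rewrite linear0 scale0r. Qed.

Lemma module_combD c d :
  module_comb (fun i => c i + d i) = module_comb c + module_comb d.
Proof.
by rewrite -big_split; apply: eq_bigr => i _; rewrite linearD scalerDl.
Qed.

Lemma module_combZ (k : K) c :
  module_comb (fun i => k *: c i) = k%:A *: module_comb c.
Proof.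
by rewrite scaler_sumr; apply: eq_bigr => i _; rewrite linearZ scale_weylZ.
Qed.

(** Freeness of the family separates the indices i; independence of the operators separates the
    coefficients. Expansions in the monomials of E are thus unique. *)
Lemma module_comb_inj c d : [pchar K] =i pred0 -> free_basis f ->
  module_comb c = module_comb d -> c =1 d.
Proof.
move=> charK [_ f_free] cd i; apply: (weyl_comb_inj charK); apply/eqP.
rewrite -subr_eq0; apply/eqP; move: i; apply: f_free.
under eq_bigr do rewrite scalerBl.
by rewrite sumrB -/(module_comb c) cd subrr.
Qed.

End Family.

Lemma linear_module_comb (M E : lmodType A) m (e : 'I_m -> E) (f : 'I_m -> M)
    (pi : {linear E -> M}) (pi_e : forall i, pi (e i) = f i) c :
  pi (module_comb e c) = module_comb f c.
Proof. by rewrite linear_sum; apply: eq_bigr => i _; rewrite linearZ /= pi_e. Qed.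

End ModuleCombinations.

Section LeadingMonomials.
Variables (K : fieldType) (n m : nat).
Local Notation A := (weyl K n).

(** The order is lexicographic: the well-founded order of exponents first, then the index. *)
Lemma fmono_ind (P : fmono n m -> Prop) :
  (forall t, (forall u, fmono_lt u t -> P u) -> P t) -> forall t, P t.
Proof.
move=> IH [v i]; elim/(@ltmwf (n + n)): v i => v IHv i.
have [k] := ubnP i; elim: k i => // k IHk i; rewrite ltnS => le_ik.
apply: IH => -[w j] [/= lt_wv|/= [-> lt_ji]]; first exact: IHv.
by apply: IHk; apply: leq_trans le_ik.
Qed.

Lemma fmono_lt_asym (t u : fmono n m) : fmono_lt t u -> ~ fmono_lt u t.
Proof.
move=> [lt_tu|[eq_tu lt_tu]] [lt_ut|[eq_ut lt_ut]].
- by have := lt_trans lt_tu lt_ut; rewrite ltxx.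
- by rewrite eq_ut ltxx in lt_tu.
- by rewrite eq_tu ltxx in lt_ut.
- by have := ltn_trans lt_tu lt_ut; rewrite ltnn.
Qed.

Variables (E : lmodType A) (e : 'I_m -> E).

(** [is_LM] only asserts that some expansion exists; uniqueness transfers its leading coefficient to
    the given one. *)
Lemma is_LM_coeff_neq0 c t : [pchar K] =i pred0 -> free_basis e ->
  is_LM e (module_comb e c) t -> (c t.2)@_t.1 != 0.
Proof.
move=> charK e_basis [d [cd d_t _]].
by rewrite (module_comb_inj charK e_basis cd).
Qed.

Lemma is_LM_inj h t u : [pchar K] =i pred0 -> free_basis e ->
  is_LM e h t -> is_LM e h u -> t = u.
Proof.
move=> charK e_basis [c [-> c_t c_le]] hu.
have /c_le[->//|lt_ut] := is_LM_coeff_neq0 charK e_basis hu.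
have [d [cd d_u d_le]] := hu.
have [->//|lt_tu] : t = u \/ fmono_lt t u.
  by apply: d_le; rewrite -(module_comb_inj charK e_basis cd).
by have := fmono_lt_asym lt_tu lt_ut.
Qed.

(** The symbol translates all exponents by w, up to terms of degree below |w| + |t.1|. The order
    compares degrees first and is translation invariant, so the leading term stays in front. *)
Lemma is_LM_mono h t w :
  is_LM e h t -> is_LM e (weyl_mono K w *: h) ((w + t.1)%MM, t.2).
Proof.
move=> [c [-> c_t c_le]].
have c_size i : (msize (c i) <= (mdeg t.1).+1)%N.
  apply/msize_leP => v c_v; rewrite ltnS.
  have [<- //|[/= lt_v|[/= -> _]//]] := c_le (v, i) c_v.
  exact/lemc_mdeg/ltW.
have [d d_size dE] := fin_all_exists2 (fun i => has_symbol_mono w (c_size i)).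
have d_eq0 i v : (mdeg w + mdeg t.1 <= mdeg v)%N -> (d i)@_v = 0.
  by move=> le_v; apply/memN_msupp_eq0/msize_mdeg_ge/(leq_trans (d_size i)).
exists (fun i => 'X_[w] * c i + d i); split=> [||[v i] /=].
- by rewrite scaler_sumr; apply: eq_bigr => i _; rewrite scalerA dE.
- by rewrite mcoeffD mcoeffXM_add d_eq0 ?mdegD // addr0.
(* Below the top degree a term is smaller by degree alone; from there on the correction [d] vanishes
   and only translated terms of [c] remain. *)
have [lt_v|le_v] := ltnP (mdeg v) (mdeg w + mdeg t.1).
  by move=> _; right; left; apply: lt_mdeg_ltmc; rewrite mdegD.
rewrite mcoeffD d_eq0 // addr0 => /mcoeffXM_neq0[v' c_v' ->].
have [<-|[lt_v'|[/= -> lt_i]]] := c_le (v', i) c_v'; first by left.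
  by right; left; rewrite /= ltmc_add2r.
by right; right.
Qed.

End LeadingMonomials.

(** * Normal forms modulo the Groebner basis and a basis of M_r *)

Section NormalForms.
Variables (K : fieldType) (charK : [pchar K] =i pred0) (n : nat).
Local Notation A := (weyl K n).
Variables (M E : lmodType A) (m : nat) (f : 'I_m -> M) (e : 'I_m -> E).
Hypothesis e_basis : free_basis e.
Variable pi : {linear E -> M}.
Hypothesis pi_e : forall i, pi (e i) = f i.
Variables (s : nat) (g : 'I_s -> E).
Hypothesis g_groebner : groebner_basis e (fun u => pi u = 0) g.

Definition normal_comb r (c : 'I_m -> {mpoly K[n + n]}) :=
  forall i v, (c i)@_v != 0 -> LM_free e g i v /\ (mdeg v <= r)%N.

Definition normal_span r u := exists2 c, normal_comb r c & u = module_comb f c.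

Lemma normal_span0 r : normal_span r 0.
Proof.
exists (fun=> 0); last by rewrite module_comb0.
by move=> i v; rewrite mcoeff0 eqxx.
Qed.

Lemma normal_spanD r u v : normal_span r u -> normal_span r v -> normal_span r (u + v).
Proof.
move=> [c cN ->] [d dN ->]; exists (fun i => c i + d i); last by rewrite module_combD.
move=> i w; rewrite mcoeffD => cd_w.
have [c_w|/negPn/eqP c_w] := boolP ((c i)@_w != 0); first exact: cN.
by apply: dN; rewrite c_w add0r in cd_w.
Qed.

Lemma normal_spanZ r (k : K) u : normal_span r u -> normal_span r (k%:A *: u).
Proof.
move=> [c cN ->]; exists (fun i => k *: c i); last by rewrite module_combZ.
move=> i w; rewrite mcoeffZ => kc_w; apply: cN.
by apply: contraNneq kc_w => ->; rewrite mulr0.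
Qed.

Lemma normal_span_module_comb r c :
  (forall i v, (c i)@_v != 0 -> normal_span r (weyl_mono K v *: f i)) ->
  normal_span r (module_comb f c).
Proof.
move=> cN; rewrite /module_comb; elim/big_ind: _ => [||i _].
- exact: normal_span0.
- exact: normal_spanD.
rewrite /weyl_comb scaler_suml big_seq; elim/big_ind: _ => [||v].
- exact: normal_span0.
- exact: normal_spanD.
rewrite mcoeff_msupp => c_v; rewrite scale_weylZ.
exact/normal_spanZ/cN.
Qed.

(** Noetherian induction on the monomial: a reducible one leads a multiple of some g_j, which [pi]
    kills, so its image is a combination of images of smaller monomials. These have no larger
    degree. *)
Lemma normal_span_mono r (t : fmono n m) :
  (mdeg t.1 <= r)%N -> normal_span r (weyl_mono K t.1 *: f t.2).
Proof.
elim/fmono_ind: t => -[v i] IH /= v_r.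
have [v_free|] := EM (LM_free e g i v).
  exists (fun k => if k == i then 'X_[v] else 0).
    move=> k w; case: (eqVneq k i) => [->|_]; last by rewrite mcoeff0 eqxx.
    by rewrite mcoeffX; case: (eqVneq v w) => [<-|_]; rewrite ?eqxx.
  rewrite /module_comb (bigD1 i) //= eqxx weyl_combX big1 ?addr0 // => k /negbTE ->.
  by rewrite linear0 scale0r.
move=> /existsNP[j /existsNP[t /not_implyP[g_t /contrapT[/= ti t_v]]]].
have [d [dE]] := is_LM_mono (v - t.1)%MM g_t.
rewrite /= submK // ti => d_v d_le.
have pi_d : module_comb f d = 0.
  rewrite -(linear_module_comb pi_e) /module_comb -dE linearZ /=.
  by have [_ -> _] := g_groebner; rewrite scaler0.
(* The multiple of g_j with its leading term removed; only monomials below v e_i survive. *)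
pose c k := if k == i then d k - (d i)@_v *: 'X_[v] else d k.
have c_lt k w : (c k)@_w != 0 -> fmono_lt (w, k) (v, i).
  rewrite /c; case: (eqVneq k i) => [->|ne_ki] c_w.
    have [eq_wv|ne_wv] := eqVneq v w.
      by rewrite mcoeffB mcoeffZ mcoeffX -eq_wv eqxx mulr1 subrr eqxx in c_w.
    have [|[/esym eq_wv]|//] := d_le (w, i).
      by rewrite mcoeffB mcoeffZ mcoeffX (negbTE ne_wv) mulr0 subr0 in c_w.
    by rewrite eq_wv eqxx in ne_wv.
  have [//|[_ eq_ki]|//] := d_le (w, k).
  by rewrite eq_ki eqxx in ne_ki.
have cN : normal_span r (module_comb f c).
  apply: normal_span_module_comb => k w /c_lt lt_w; apply: (IH (w, k)) => //=.
  by apply: leq_trans v_r; case: lt_w => [/ltW/lemc_mdeg|[/= -> _]].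
have : module_comb f d = module_comb f c + ((d i)@_v)%:A *: (weyl_mono K v *: f i).
  rewrite /module_comb (bigD1 i) //= [in RHS](bigD1 i) //= addrAC /c eqxx.
  congr (_ + _); last by apply: eq_bigr => k /negbTE ->.
  by rewrite linearB linearZ /= weyl_combX scalerBl scale_weylZ subrK.
rewrite pi_d => /esym/eqP; rewrite addrC addr_eq0 => /eqP vE.
(* The leading coefficient is a nonzero element of the field, so the relation is solved for the
   image of v e_i. *)
have -> : weyl_mono K v *: f i = (- ((d i)@_v)^-1)%:A *: module_comb f c.
  rewrite -[module_comb f c]opprK -vE scalerN -scale_weylZ [_ *: _%:A]scalerA.
  by rewrite mulNr mulVf // !scaleNr !scale1r opprK.
exact: normal_spanZ.
Qed.

(** A relation lifts to an element of the kernel. Were it nonzero, its leading monomial would be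
    divisible by some LM(g_j), yet it occurs in c and is irreducible. *)
Lemma normal_comb_free r c : normal_comb r c -> module_comb f c = 0 -> forall i, c i = 0.
Proof.
move=> cN; rewrite -(linear_module_comb pi_e) => c0.
have [u0|u_neq0] := eqVneq (module_comb e c) 0.
  by apply: (module_comb_inj charK e_basis); rewrite u0 module_comb0.
have [_ _ /(_ _ c0 u_neq0)[j [t [u [g_t c_u t_u]]]]] := g_groebner.
have [u_free _] := cN _ _ (is_LM_coeff_neq0 charK e_basis c_u).
by case: (u_free j t g_t); case: (u) t_u.
Qed.

Lemma module_filtrationP r u : module_filtration f r u <-> normal_span r u.
Proof.
split=> [[b [b_r ->]]|[c cN ->]]; last first.
  exists (fun i => weyl_comb (c i)); split=> // i; apply/bernsteinP.
  by exists (c i) => //; apply/msize_leP => v /cN[_]; rewrite ltnS.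
have [c c_r bE] := fin_all_exists2 (fun i => (bernsteinP r (b i)).1 (b_r i)).
have -> : \sum_i b i *: f i = module_comb f c by apply: eq_bigr => i _; rewrite bE.
apply: normal_span_module_comb => i v c_v; apply: (@normal_span_mono r (v, i)).
by rewrite -ltnS /=; apply: (msize_leP _ _ (c_r i)).
Qed.

Lemma has_Kdim_module_filtration r :
  has_Kdim (module_filtration f r) (\sum_(i < m) card_le (LM_free e g i) r)%N.
Proof.
(* The disjoint union of the sets V_i(r); its enumeration indexes the basis. *)
pose P := [pred x : 'I_m * 'X_{1..(n + n) < r.+1} | `[< LM_free e g x.1 x.2 >]].
have -> : (\sum_(i < m) card_le (LM_free e g i) r = #|P|)%N.
  transitivity (\sum_(i < m)
      \sum_(v : 'X_{1..(n + n) < r.+1} | `[< LM_free e g i v >]) 1)%N.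
    by apply: eq_bigr => i _; rewrite sum1_card.
  by rewrite pair_big_dep sum1_card.
pose idx (k : 'I_#|P|) := (enum_val k).1.
pose mon (k : 'I_#|P|) : 'X_{1..n + n} := (enum_val k).2.
have idx_mon_inj k l : idx k = idx l -> mon k = mon l -> k = l.
  move=> eq_idx eq_mon; apply: enum_val_inj; move: eq_idx eq_mon.
  rewrite /idx /mon; case: (enum_val k) (enum_val l) => [i v] [j w] /= -> vw.
  by congr (_, _); apply: val_inj.
have mon_ex i v : LM_free e g i v -> (mdeg v <= r)%N ->
    exists k, idx k = i /\ mon k = v.
  move=> v_free; rewrite -ltnS => v_r; have xP : (i, BMultinom v_r) \in P.
    by rewrite inE; apply/asboolP.
  by exists (enum_rank_in xP (i, BMultinom v_r)); rewrite /idx /mon enum_rankK_in.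
(* Converts coordinates along the enumeration into coefficient families; [poly_mon] recovers the
   coordinates. *)
pose poly (c : 'I_#|P| -> K) i := \sum_(k | idx k == i) c k *: 'X_[mon k].
have coef_poly c i v : (poly c i)@_v = \sum_(k | idx k == i) c k * (mon k == v)%:R.
  by rewrite raddf_sum; apply: eq_bigr => k _; rewrite /= mcoeffZ mcoeffX.
have poly_mon c k : (poly c (idx k))@_(mon k) = c k.
  rewrite coef_poly (bigD1 k) //= eqxx mulr1 big1 ?addr0 // => l /andP[/eqP idx_lk ne_lk].
  case: eqP => [mon_lk|_]; last by rewrite mulr0.
  by rewrite (idx_mon_inj l k) ?eqxx in ne_lk.
have poly_neq0 c i v : (poly c i)@_v != 0 -> exists k, idx k = i /\ mon k = v.
  rewrite coef_poly => c_v; apply: contrapT => no_k; case/eqP: c_v.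
  apply: big1 => k /eqP idx_k; case: eqP => [mon_k|_]; last by rewrite mulr0.
  by case: no_k; exists k.
have poly_normal c : normal_comb r (poly c).
  move=> i v /poly_neq0[k [<- <-]]; split; last by rewrite -ltnS bmdeg.
  by have := enum_valP k; rewrite inE => /asboolP.
pose b k : M := weyl_mono K (mon k) *: f (idx k).
have polyE c : module_comb f (poly c) = \sum_k (c k)%:A *: b k.
  rewrite (partition_big idx xpredT) //=; apply: eq_bigr => i _.
  rewrite linear_sum scaler_suml; apply: eq_bigr => k /eqP <-.
  by rewrite linearZ /= weyl_combX scale_weylZ.
exists b; split=> [c|u].
  rewrite -polyE => /(normal_comb_free (poly_normal c)) c0 k.
  by rewrite -(poly_mon c k) c0 mcoeff0.
split=> [/module_filtrationP[c cN ->]|[c ->]]; last first.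
  by apply/module_filtrationP; exists (poly c) => //; rewrite polyE.
exists (fun k => (c (idx k))@_(mon k)); rewrite -polyE.
apply: eq_module_comb => i; apply/mpolyP => v.
have [[k [<- <-]]|no_k] := EM (exists k, idx k = i /\ mon k = v).
  by rewrite poly_mon.
(* Away from the enumerated pairs, both families have coefficient zero. *)
have vanish (p : {mpoly K[n + n]}) :
    (p@_v != 0 -> exists k, idx k = i /\ mon k = v) -> p@_v = 0.
  by move=> p_v; have [//|/p_v/no_k] := eqVneq p@_v 0.
rewrite (vanish (poly _ i) (@poly_neq0 _ _ _)) vanish // => /cN[v_free v_r].
exact: mon_ex.
Qed.

(** The list collects the exponents of those LM(g_j) that lie on e_i; finiteness comes from the
    finite range of j. *)
Lemma LM_free_above_any i : exists L, forall v, LM_free e g i v <-> ~~ above_any L v.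
Proof.
(* [None] is the value when g_j has no leading monomial; otherwise uniqueness makes the choice
   exact. *)
have /fin_all_exists[lm lmP] j : exists o : option (fmono n m),
    forall t, is_LM e (g j) t <-> o = Some t.
  have [[t g_t]|no_t] := EM (exists t, is_LM e (g j) t).
    exists (Some t) => u; split=> [g_u|[<-] //].
    by rewrite (is_LM_inj charK e_basis g_t g_u).
  by exists None => t; split=> // g_t; case: no_t; exists t.
exists [seq t.1 | t : fmono n m <- pmap lm (enum 'I_s) & t.2 == i] => v.
rewrite /above_any has_map has_filter -filter_predI -has_filter.
have mem_lm t : t \in pmap lm (enum 'I_s) <-> exists j, is_LM e (g j) t.
  rewrite mem_pmap; split=> [/mapP[j _ /esym/lmP g_t]|[j /lmP g_t]]; first by exists j.
  by apply/mapP; exists j; rewrite ?mem_enum.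
split=> [v_free|/hasPn no_t j t g_t [/= ti t_v]].
  apply/hasPn => t /mem_lm[j g_t]; apply/negP => /andP[t_v /eqP ti].
  exact: v_free g_t (conj ti t_v).
have /no_t : t \in pmap lm (enum 'I_s) by apply/mem_lm; exists j.
by rewrite /= t_v ti eqxx.
Qed.

End NormalForms.

(** * The dimension polynomial as a sum of Kolchin polynomials *)

Theorem theorem10
  (K : fieldType) (charK : [pchar K] =i pred0) (n : nat) (n_gt0 : (0 < n)%N)
  (M : lmodType (weyl K n)) (m : nat) (f : 'I_m -> M) (f_gen : generates f)
  (E : lmodType (weyl K n)) (e : 'I_m -> E) (e_basis : free_basis e)
  (pi : {linear E -> M}) (pi_e : forall i, pi (e i) = f i)
  (s : nat) (g : 'I_s -> E)
  (g_groebner : groebner_basis e (fun u => pi u = 0) g) :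
  exists chi : {poly rat},
    [/\ numerical chi,
        exists r0 : int, forall r : nat, r0 <= r%:Z ->
          exists d : nat,
            has_Kdim (module_filtration f r) d /\ chi.[r%:R] = d%:R,
        (size chi <= (2 * n).+1)%N /\
        (exists a : 'I_(2 * n).+1 -> int,
           chi = \sum_(i < (2 * n).+1)
                   (a i)%:~R *: binomp ('X + (i%:R)%:P) i)
      & exists omega : 'I_m -> {poly rat},
          (forall i, is_kolchin_of (LM_free e g i) (omega i)) /\
          chi = \sum_(i < m) omega i].
Proof.
have [L LP] := fin_all_exists (LM_free_above_any charK e_basis g).
have [omega omegaP] := fin_all_exists (fun i => exists_kolchin (LP i)).
have /fin_all_exists[r0 r0P] i : exists r0, forall r, (r0 <= r)%N ->
    (omega i).[r%:R] = (card_le (LM_free e g i) r)%:R.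
  by have [] := omegaP i.
have chi_span : integer_valued_span (n + n) (\sum_(i < m) omega i).
  by apply: integer_valued_span_sum => i; have [] := omegaP i.
exists (\sum_(i < m) omega i); split.
- exact: numerical_integer_valued_span chi_span.
(* The sum of the thresholds dominates each of them. *)
- exists (\sum_(i < m) r0 i)%N%:Z => r; rewrite lez_nat => r0_r.
  exists (\sum_(i < m) card_le (LM_free e g i) r)%N; split.
    exact (has_Kdim_module_filtration charK e_basis pi_e g_groebner r).
  rewrite horner_sum natr_sum; apply: eq_bigr => i _; apply: r0P.
  by apply: leq_trans r0_r; rewrite (bigD1 i) //= leq_addr.
- rewrite mul2n -addnn; split; first exact: size_integer_valued_span.
  by have [a ->] := chi_span; exists (fun i => a i).
by exists omega; split=> // i; have [] := omegaP i.
Qed.
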